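(* Let $A_1,A_2,\dots,A_N\in\mathbb{C}^{n\times n}$ be given. Then: (i) $I+\sum_{i=1}^NA_i$ is nonsingular if there exists $\theta\in\mathbb{R}$ such that $$-1\notin\sum_{i=1}^N\mathrm{SRG}_\theta(\mathcal{A}_i),$$ where each $\mathcal{A}_i\subset\mathbb{C}^{n\times n}$ is an arbitrary matrix set containing $A_i$, and at least $N-1$ of the $\mathcal{A}_i$ satisfy the $\theta$-chord property; (ii) $I+\prod_{i=1}^NA_i$ is nonsingular if there exist $\theta_i\in\mathbb{R}$, $i=1,2,\dots,N$, such that $$-1\notin\prod_{i=1}^N\mathrm{SRG}_{\theta_i}(\mathcal{A}_i),$$ where each $\mathcal{A}_i\subset\mathbb{C}^{n\times n}$ is an arbitrary matrix set containing $A_i$, and at least $N-1$ of the $\mathcal{A}_i$ satisfy the $\theta_i$-arc property.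
   Context: $j$ is the imaginary unit, $\langle x,y\rangle=x^Hy$, and $\|\cdot\|$ is the Euclidean norm. For $x,y\in\mathbb{C}^n$ and $\theta\in\mathbb{R}$, $\angle_\theta(x,y)\in[0,\pi]$ is $\arccos\frac{\mathrm{Re}\langle x,e^{-j\theta}y\rangle}{\|x\|\|y\|}$ if $x\neq0,y\neq0$, and $0$ if $x=0$ or $y=0$. The $\theta$-symmetric scaled relative graph of $C\in\mathbb{C}^{n\times n}$ is $$\mathrm{SRG}_\theta(C)=\Big\{\tfrac{\|Cx\|}{\|x\|}\exp\{j(\theta\pm\angle_\theta(x,Cx))\}:0\neq x\in\mathbb{C}^n\Big\}$$ (both signs included), and for a set of matrices $\mathcal{C}$, $\mathrm{SRG}_\theta(\mathcal{C})=\bigcup_{C\in\mathcal{C}}\mathrm{SRG}_\theta(C)$. For $z\in\mathbb{C}$, $\mathrm{Chord}_\theta(z)$ is the closed line segment joining $z$ and its mirror image $\overline{z}e^{2j\theta}$ across the line $e^{j\theta}\mathbb{R}$. $\mathrm{Arc}^+_\theta(z)$ (resp. $\mathrm{Arc}^-_\theta(z)$) is the circular arc centered at the origin joining $z$ and $\overline{z}e^{2j\theta}$ that crosses the ray $e^{j\theta}\mathbb{R}^+$ (resp. $e^{j\theta}\mathbb{R}^-$); i.e., writing $z=|z|e^{j(\theta\pm\psi)}$ with $\psi\in[0,\pi]$, $\mathrm{Arc}^+_\theta(z)=\{|z|e^{j(\theta+\varphi)}:|\varphi|\le\psi\}$ and $\mathrm{Arc}^-_\theta(z)=\{|z|e^{j(\theta+\varphi)}:\psi\le|\varphi|\le\pi\}$.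 A matrix set $\mathcal{C}$ satisfies the $\theta$-chord property if $\mathrm{Chord}_\theta(z)\subset\mathrm{SRG}_\theta(\mathcal{C})$ for all $z\in\mathrm{SRG}_\theta(\mathcal{C})$. It satisfies the $\theta$-arc property if either $\mathrm{Arc}^+_\theta(z)\subset\mathrm{SRG}_\theta(\mathcal{C})$ for all $z\in\mathrm{SRG}_\theta(\mathcal{C})$, or $\mathrm{Arc}^-_\theta(z)\subset\mathrm{SRG}_\theta(\mathcal{C})$ for all $z\in\mathrm{SRG}_\theta(\mathcal{C})$. Sums and products of subsets of $\mathbb{C}$ are elementwise; $\prod_{i=1}^NA_i=A_1A_2\cdots A_N$. *)

(* Defs.v *)
From HB Require Import structures.
From mathcomp Require Import all_boot all_order all_algebra.
From mathcomp Require Import classical_sets reals trigo.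
From mathcomp Require Import complex.

Set Implicit Arguments.
Unset Strict Implicit.
Unset Printing Implicit Defensive.
Import Order.TTheory GRing.Theory Num.Theory.
Local Open Scope ring_scope.
Local Open Scope complex_scope.
Local Open Scope classical_set_scope.

Definition expj (R : realType) (t : R) : R[i] := cos t +i* sin t.

(* Real-valued modulus: the norm `|z| of R[i] takes its values in R[i]. *)
Definition cmod (R : realType) (z : R[i]) : R := complex.Re `|z|.

(* <x, y> = x^H y, conjugate-linear in the first argument *)
Definition dotc (R : realType) (n : nat) (x y : 'cV[R[i]]_n) : R[i] :=
  ((map_mx conjc x)^T *m y) 0 0.

Definition enorm (R : realType) (n : nat) (x : 'cV[R[i]]_n) : R :=
  Num.sqrt (\sum_(k < n) cmod (x k 0) ^+ 2).

Definition angle (R : realType) (n : nat) (theta : R) (x y : 'cV[R[i]]_n) : R :=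
  if (x == 0) || (y == 0) then 0
  else acos (complex.Re (dotc x (expj (- theta) *: y)) / (enorm x * enorm y)).

Definition SRG (R : realType) (n : nat) (theta : R) (C : 'M[R[i]]_n) : set R[i] :=
  [set z | exists2 x : 'cV[R[i]]_n, x != 0 &
     let rho := enorm (C *m x) / enorm x in
     let psi := angle theta x (C *m x) in
     z = rho%:C * expj (theta + psi) \/ z = rho%:C * expj (theta - psi)].

Definition SRG_set (R : realType) (n : nat) (theta : R)
    (calC : set 'M[R[i]]_n) : set R[i] :=
  \bigcup_(C in calC) SRG theta C.

Definition chord (R : realType) (theta : R) (z : R[i]) : set R[i] :=
  [set w | exists2 t : R, 0 <= t <= 1 &
     w = (1 - t)%:C * z + t%:C * (z^* * expj (2 * theta))].

(* psi is determined by z when z != 0; for z = 0 any psi is allowed, and both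
   arcs below are the singleton of 0. *)
Definition polar_angle (R : realType) (theta : R) (z : R[i]) (psi : R) : Prop :=
  0 <= psi <= pi /\
  (z = (cmod z)%:C * expj (theta + psi) \/ z = (cmod z)%:C * expj (theta - psi)).

Definition arc_pos (R : realType) (theta : R) (z : R[i]) : set R[i] :=
  [set w | exists psi phi : R, [/\ polar_angle theta z psi, `|phi| <= psi &
     w = (cmod z)%:C * expj (theta + phi)]].

Definition arc_neg (R : realType) (theta : R) (z : R[i]) : set R[i] :=
  [set w | exists psi phi : R, [/\ polar_angle theta z psi, psi <= `|phi| <= pi &
     w = (cmod z)%:C * expj (theta + phi)]].

Definition chord_property (R : realType) (n : nat) (theta : R)
    (calC : set 'M[R[i]]_n) : Prop :=
  forall z : R[i], SRG_set theta calC z ->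
    chord theta z `<=` SRG_set theta calC.

Definition arc_property (R : realType) (n : nat) (theta : R)
    (calC : set 'M[R[i]]_n) : Prop :=
  (forall z : R[i], SRG_set theta calC z ->
     arc_pos theta z `<=` SRG_set theta calC) \/
  (forall z : R[i], SRG_set theta calC z ->
     arc_neg theta z `<=` SRG_set theta calC).

Definition sum_sets (R : realType) (N : nat) (S : 'I_N -> set R[i]) : set R[i] :=
  [set z | exists2 w : 'I_N -> R[i], (forall i, S i (w i)) & z = \sum_(i < N) w i].

Definition prod_sets (R : realType) (N : nat) (S : 'I_N -> set R[i]) : set R[i] :=
  [set z | exists2 w : 'I_N -> R[i], (forall i, S i (w i)) & z = \prod_(i < N) w i].

Definition at_least (N m : nat) (P : 'I_N -> Prop) : Prop :=
  exists2 J : {set 'I_N}, (m <= #|J|)%N & forall i, i \in J -> P i.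

(* Main.v *)
(* A kernel vector x of I + sum A_i splits each e^{-j theta} A_i x into a real
   multiple of x and a vector r_i real-orthogonal to x. The r_i add up to
   (j sin theta) x, so by the triangle inequality none of |sin theta|,
   |r_1| / |x|, ..., |r_N| / |x| exceeds the sum of the others; hence sin theta is
   a sum of numbers t_i with |t_i| <= |r_i| / |x|, with equality for one chosen
   index, and the chord property provides the points with imaginary part t_i.
   For the product, the vectors x, A_N x, A_(N-1) A_N x, ... ending in -x,
   suitably rotated, form a path whose consecutive angles are the phases of the
   scaled relative graphs; the triangle inequality for angles replaces that for
   norms, and the arc property supplies the intermediate phases. *)
Require Import Defs.
From mathcomp Require Import all_boot all_order all_algebra.
From mathcomp Require Import classical_sets reals trigo.
From mathcomp Require Import complex.
From mathcomp Require Import ring lra zify.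
Local Open Scope ring_scope.

Set Implicit Arguments.
Unset Strict Implicit.
Unset Printing Implicit Defensive.
Import Order.TTheory GRing.Theory Num.Theory.
Local Open Scope complex_scope.

(** * Unit complex numbers, phases and moduli *)

Section Phases.
Variable R : realType.
Implicit Types (a b t : R) (z w : R[i]).

Lemma complex_eqP z w :
  complex.Re z = complex.Re w -> complex.Im z = complex.Im w -> z = w.
Proof. by case: z w => [a b] [c d] /= -> ->. Qed.

Lemma expj0 : expj (0 : R) = 1.
Proof. by rewrite /expj cos0 sin0. Qed.

Lemma expjD a b : expj (a + b) = expj a * expj b.
Proof. by apply: complex_eqP; rewrite /= ?cosD ?sinD //; ring. Qed.

Lemma expjDpi a : expj (a + pi) = - expj a.
Proof. by rewrite /expj cosDpi sinDpi. Qed.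

Lemma expj_sum (I : Type) (r : seq I) (P : pred I) (F : I -> R) :
  expj (\sum_(i <- r | P i) F i) = \prod_(i <- r | P i) expj (F i).
Proof. exact: (big_morph _ expjD expj0). Qed.

(** This provides a representative of the phase in [-pi, pi]: [acos (cos a)] has the right cosine,
    and the sign of [sin a] decides between it and its opposite. *)
Lemma expj_principal a :
  exists2 d : R, expj d = expj a & `|d| = acos (cos a).
Proof.
have hc : -1 <= cos a <= 1 by rewrite cos_geN1 cos_le1.
have hac : cos (acos (cos a)) = cos a by rewrite acosK.
have hs : sin (acos (cos a)) = `|sin a|.
  by rewrite sin_acos // -sin2cos2 sqrtr_sqr.
have h0 := acos_ge0 hc.
have [s0|s0] := leP 0 (sin a).
  by exists (acos (cos a)); rewrite ?ger0_norm // /expj hac hs ger0_norm.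
exists (- acos (cos a)); last by rewrite normrN ger0_norm.
by rewrite /expj cosN sinN hac hs ltr0_norm // opprK.
Qed.

Lemma cmodE z : cmod z = Num.sqrt (complex.Re z ^+ 2 + complex.Im z ^+ 2).
Proof. by rewrite /cmod normc_def. Qed.

Lemma cmod_polar (r t : R) : 0 <= r -> cmod (r%:C * expj t) = r.
Proof.
move=> r0; rewrite cmodE /= !mul0r subr0 addr0 !exprMn -mulrDr cos2Dsin2 mulr1.
by rewrite sqrtr_sqr ger0_norm.
Qed.

End Phases.

(** * The real inner product on complex vectors, its norm and its angles *)

Section RealInnerProduct.
Variables (R : realType) (n : nat).
Implicit Types (x y z : 'cV[R[i]]_n) (a r t : R).

(** This is the Euclidean inner product of the underlying real space of dimension 2n; scaled
    relative graphs measure angles with it. *)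
Definition rdot x y : R := complex.Re (dotc x y).

Lemma rdotE x y : rdot x y =
  \sum_k (complex.Re (x k 0) * complex.Re (y k 0) +
          complex.Im (x k 0) * complex.Im (y k 0)).
Proof.
rewrite /rdot /dotc mxE (raddf_sum (@complex.Re R : Rcomplex R -> R)).
by apply: eq_bigr => k _; rewrite !mxE; case: (x k 0) (y k 0) => [? ?] [? ?] /=; ring.
Qed.

Lemma rdotC x y : rdot x y = rdot y x.
Proof. by rewrite !rdotE; apply: eq_bigr => k _; ring. Qed.

Lemma rdotDl x y z : rdot (x + y) z = rdot x z + rdot y z.
Proof.
rewrite !rdotE -big_split; apply: eq_bigr => k _; rewrite !mxE /=.
by case: (x k 0) (y k 0) => [? ?] [? ?] /=; ring.
Qed.

Lemma rdotZl a x y : rdot (a%:C *: x) y = a * rdot x y.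
Proof.
rewrite !rdotE mulr_sumr; apply: eq_bigr => k _; rewrite !mxE /=.
by case: (x k 0) => [? ?] /=; ring.
Qed.

Lemma rdotNl x y : rdot (- x) y = - rdot x y.
Proof.
rewrite !rdotE -sumrN; apply: eq_bigr => k _; rewrite !mxE /=.
by case: (x k 0) => [? ?] /=; ring.
Qed.

Lemma rdotDr x y z : rdot x (y + z) = rdot x y + rdot x z.
Proof. by rewrite rdotC rdotDl !(rdotC x). Qed.

Lemma rdotZr a x y : rdot x (a%:C *: y) = a * rdot x y.
Proof. by rewrite rdotC rdotZl rdotC. Qed.

Lemma rdotNr x y : rdot x (- y) = - rdot x y.
Proof. by rewrite rdotC rdotNl rdotC. Qed.

Lemma rdot_suml (I : Type) (r : seq I) (P : pred I) (F : I -> 'cV[R[i]]_n) y :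
  rdot (\sum_(i <- r | P i) F i) y = \sum_(i <- r | P i) rdot (F i) y.
Proof.
apply: (big_morph (fun x => rdot x y) (fun u v => rdotDl u v y)).
by rewrite -(addr0 (rdot 0 y)) -(subrr (rdot 0 y)) addrA -rdotDl addr0 subrr.
Qed.

Lemma rdot_expj a x y : rdot (expj a *: x) (expj a *: y) = rdot x y.
Proof.
rewrite !rdotE; apply: eq_bigr => k _; rewrite !mxE /=.
case: (x k 0) (y k 0) => [b c] [d e] /=.
transitivity ((cos a ^+ 2 + sin a ^+ 2) * (b * d + c * e)); first by ring.
by rewrite cos2Dsin2 mul1r.
Qed.

Lemma rdot_expjr a x : rdot x (expj a *: x) = cos a * rdot x x.
Proof.
rewrite !rdotE mulr_sumr; apply: eq_bigr => k _; rewrite !mxE /=.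
by case: (x k 0) => [b c] /=; ring.
Qed.

Lemma rdot_ge0 x : 0 <= rdot x x.
Proof. by rewrite rdotE sumr_ge0 // => k _; rewrite addr_ge0 // -expr2 sqr_ge0. Qed.

Lemma rdot_eq0 x : (rdot x x == 0) = (x == 0).
Proof.
apply/idP/eqP => [|->]; last first.
  by rewrite rdotE big1 // => k _; rewrite !mxE /= !mul0r addr0.
have h (k : 'I_n) : true -> 0 <= complex.Re (x k 0) * complex.Re (x k 0) +
    complex.Im (x k 0) * complex.Im (x k 0).
  by move=> _; rewrite addr_ge0 // -expr2 sqr_ge0.
rewrite rdotE psumr_eq0 // => /allP hx; apply/matrixP => k j.
rewrite (ord1 j) !mxE; have := hx k (mem_index_enum k).
rewrite /= -!expr2 paddr_eq0 ?sqr_ge0 // !sqrf_eq0 => /andP[/eqP hr /eqP hi].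
exact: complex_eqP.
Qed.

Lemma enormE x : enorm x = Num.sqrt (rdot x x).
Proof.
rewrite /enorm rdotE; congr Num.sqrt; apply: eq_bigr => k _.
by rewrite cmodE sqr_sqrtr ?addr_ge0 ?sqr_ge0 // !expr2.
Qed.

Lemma enorm_ge0 x : 0 <= enorm x.
Proof. by rewrite enormE sqrtr_ge0. Qed.

Lemma sqr_enorm x : enorm x ^+ 2 = rdot x x.
Proof. by rewrite enormE sqr_sqrtr // rdot_ge0. Qed.

Lemma enorm_eq0 x : (enorm x == 0) = (x == 0).
Proof. by rewrite -rdot_eq0 -sqr_enorm sqrf_eq0. Qed.

Lemma enorm_expj a x : enorm (expj a *: x) = enorm x.
Proof. by rewrite !enormE rdot_expj. Qed.

Lemma enormN x : enorm (- x) = enorm x.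
Proof. by rewrite !enormE rdotNl rdotNr opprK. Qed.

Lemma enormZ a x : enorm (a%:C *: x) = `|a| * enorm x.
Proof.
by rewrite !enormE rdotZl rdotZr mulrA -expr2 sqrtrM ?sqr_ge0 // sqrtr_sqr.
Qed.

Lemma rdot_cauchy_schwarz x y : `|rdot x y| <= enorm x * enorm y.
Proof.
rewrite -ler_sqr ?nnegrE ?mulr_ge0 ?enorm_ge0 // real_normK ?num_real //.
rewrite exprMn !sqr_enorm.
have [->|y0] := eqVneq y 0.
  have h0 z : rdot z 0 = 0 by rewrite -(subrr z) rdotDr rdotNr subrr.
  by rewrite !h0 expr0n mulr0.
have hy : 0 < rdot y y by rewrite lt0r rdot_eq0 y0 rdot_ge0.
(* The square of this vector is <y,y> (<x,x> <y,y> - <x,y>^2), and <y,y> > 0. *)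
have := rdot_ge0 ((rdot y y)%:C *: x - (rdot x y)%:C *: y).
rewrite !(rdotDl, rdotDr, rdotNl, rdotNr, rdotZl, rdotZr) (rdotC y x) => h.
rewrite -subr_ge0 -(pmulr_rge0 _ hy); apply: le_trans h _.
by rewrite le_eqVlt; apply/orP; left; apply/eqP; ring.
Qed.

Lemma enormD x y : enorm (x + y) <= enorm x + enorm y.
Proof.
rewrite -ler_sqr ?nnegrE ?addr_ge0 ?enorm_ge0 // sqrrD !sqr_enorm.
rewrite rdotDl !rdotDr (rdotC y x).
have := le_trans (ler_norm _) (rdot_cauchy_schwarz x y); lra.
Qed.

Lemma enorm_sum (I : Type) (r : seq I) (P : pred I) (F : I -> 'cV[R[i]]_n) :
  enorm (\sum_(i <- r | P i) F i) <= \sum_(i <- r | P i) enorm (F i).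
Proof.
elim/big_rec2: _ => [|i a y _ h]; first by rewrite (eqP (_ : enorm 0 == 0)) ?enorm_eq0.
by apply: le_trans (enormD _ _) _; rewrite lerD2l.
Qed.

(* Here vangle x 0 = pi / 2, whereas angle theta x 0 is 0. *)
Definition vcos x y : R := rdot x y / (enorm x * enorm y).
Definition vangle x y : R := acos (vcos x y).

Lemma vcos_bound x y : -1 <= vcos x y <= 1.
Proof.
rewrite -ler_norml normrM normfV [`|enorm x * _|]ger0_norm ?mulr_ge0 ?enorm_ge0 //.
have [h|h] := eqVneq (enorm x * enorm y) 0; first by rewrite h invr0 mulr0.
rewrite ler_pdivrMr ?mul1r ?rdot_cauchy_schwarz //.
by rewrite lt0r h mulr_ge0 ?enorm_ge0.
Qed.

Lemma vangle_bound x y : 0 <= vangle x y <= pi.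
Proof. by rewrite acos_ge0 ?acos_lepi ?vcos_bound. Qed.

Lemma vcosC x y : vcos x y = vcos y x.
Proof. by rewrite /vcos rdotC mulrC [enorm y * _]mulrC [RHS]mulrC. Qed.

Lemma vangleC x y : vangle x y = vangle y x.
Proof. by rewrite /vangle vcosC. Qed.

Lemma vangle_expj a x y : vangle (expj a *: x) (expj a *: y) = vangle x y.
Proof. by rewrite /vangle /vcos rdot_expj !enorm_expj. Qed.

Lemma vangle_expjr a x : x != 0 -> vangle x (expj a *: x) = acos (cos a).
Proof.
move=> x0; rewrite /vangle /vcos rdot_expjr enorm_expj -expr2 sqr_enorm mulfK //.
by rewrite rdot_eq0.
Qed.

Lemma vangleNr x y : vangle x (- y) = pi - vangle x y.
Proof. by rewrite /vangle /vcos rdotNr enormN mulNr acosN ?vcos_bound. Qed.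

Lemma vcosE x y : x != 0 -> y != 0 ->
  vcos x y = rdot ((enorm x)^-1%:C *: x) ((enorm y)^-1%:C *: y).
Proof.
move=> x0 y0; rewrite rdotZl rdotZr /vcos.
have hx : enorm x != 0 by rewrite enorm_eq0.
have hy : enorm y != 0 by rewrite enorm_eq0.
by field; rewrite hx hy.
Qed.

Lemma enorm_normalize x : x != 0 -> enorm ((enorm x)^-1%:C *: x) = 1.
Proof.
by move=> x0; rewrite enormZ normfV (ger0_norm (enorm_ge0 x)) mulVf // enorm_eq0.
Qed.

(* Removing from u and w their components along v and applying Cauchy-Schwarz to
   the remainders bounds cos (angle u v + angle v w) by <u, w>. *)
Lemma vangle_triangle x y z : x != 0 -> y != 0 -> z != 0 ->
  vangle x z <= vangle x y + vangle y z.
Proof.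
move=> x0 y0 z0; set al := vangle x y; set be := vangle y z.
have /andP[al0 alp] : 0 <= al <= pi := vangle_bound x y.
have /andP[be0 bep] : 0 <= be <= pi := vangle_bound y z.
have /andP[ga0 gap] := vangle_bound x z.
have [hpi|/ltW hpi] := leP pi (al + be); first exact: le_trans gap hpi.
have hsum : 0 <= al + be <= pi by rewrite addr_ge0.
(* Both sides now lie in [0, pi], where the cosine decreases, so the goal becomes a lower bound for
   [vcos x z]. *)
rewrite leNgt -ltr_cos ?in_itv /= ?ga0 ?gap // -leNgt.
rewrite /vangle acosK ?in_itv /= ?vcos_bound //.
rewrite cosD ![in X in X - _](acosK) ?in_itv /= ?vcos_bound //.
rewrite !sin_acos ?vcos_bound // !vcosE //.
move: (enorm_normalize x0) (enorm_normalize y0) (enorm_normalize z0).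
set u := _ *: x; set v := _ *: y; set w := _ *: z => hu hv hw; clearbody u v w.
have u1 : rdot u u = 1 by rewrite -sqr_enorm hu expr1n.
have v1 : rdot v v = 1 by rewrite -sqr_enorm hv expr1n.
have w1 : rdot w w = 1 by rewrite -sqr_enorm hw expr1n.
have proj p : rdot p p = 1 ->
    enorm (p - (rdot p v)%:C *: v) = Num.sqrt (1 - rdot p v ^+ 2).
  move=> p1; rewrite enormE; congr Num.sqrt.
  rewrite !(rdotDl, rdotDr, rdotNl, rdotNr, rdotZl, rdotZr) (rdotC v p) p1 v1.
  by ring.
have := rdot_cauchy_schwarz (u - (rdot u v)%:C *: v) (w - (rdot w v)%:C *: v).
rewrite !proj // !(rdotDl, rdotDr, rdotNl, rdotNr, rdotZl, rdotZr) v1 (rdotC v w).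
rewrite ler_norml => /andP[h _]; lra.
Qed.

End RealInnerProduct.

(** * Points of scaled relative graphs obtained from one vector *)

Section ScaledRelativeGraph.
Variables (R : realType) (n : nat).
Implicit Types (C : 'M[R[i]]_n) (x : 'cV[R[i]]_n) (S : set 'M[R[i]]_n).
Implicit Types (theta t phi : R).

Lemma singular_kernel C : C \notin unitmx -> exists2 x : 'cV[R[i]]_n, x != 0 & C *m x = 0.
Proof.
rewrite -unitmx_tr -row_free_unit -kermx_eq0.
case/rowV0Pn => v /sub_kermxP hv v0; exists v^T; first by rewrite trmx_eq0.
by apply: trmx_inj; rewrite trmx_mul trmxK hv trmx0.
Qed.

Definition gain C x : R := enorm (C *m x) / enorm x.

Lemma gain_ge0 C x : 0 <= gain C x.
Proof. by rewrite divr_ge0 ?enorm_ge0. Qed.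

(** The sign of [phi] selects one of the two mirror images. *)
Lemma SRG_polar theta C x phi : x != 0 ->
  `|phi| = vangle x (expj (- theta) *: (C *m x)) ->
  SRG theta C ((gain C x)%:C * expj (theta + phi)).
Proof.
move=> x0 hphi; exists x => //=; rewrite -/(gain C x) /angle (negPf x0) /=.
(* Here [vangle] and [angle] disagree, but the gain vanishes and the point is 0 whatever its
   phase. *)
have [y0|y0] := eqVneq (C *m x) 0.
  left; rewrite /gain y0; have /eqP -> : enorm (0 : 'cV[R[i]]_n) == 0.
    by rewrite enorm_eq0.
  by rewrite mul0r rmorph0 !mul0r.
move: hphi; rewrite /vangle /vcos enorm_expj /rdot => <-.
by case: (ger0P phi) => _; [left | right; rewrite opprK].
Qed.

(* e^{-j theta} C x = axial * x + transverse, with Re <x, transverse> = 0. *)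
Definition axial theta C x : R :=
  rdot x (expj (- theta) *: (C *m x)) / rdot x x.
Definition transverse theta C x : 'cV[R[i]]_n :=
  expj (- theta) *: (C *m x) - (axial theta C x)%:C *: x.

Lemma axialE theta C x : x != 0 ->
  axial theta C x = gain C x * vcos x (expj (- theta) *: (C *m x)).
Proof.
move=> x0; rewrite /axial /gain /vcos enorm_expj -(sqr_enorm x).
have ex0 : enorm x != 0 by rewrite enorm_eq0.
have [y0|y0] := eqVneq (enorm (C *m x)) 0; last by field; rewrite ex0 y0.
have /eqP y0' : C *m x == 0 by rewrite -enorm_eq0 y0.
have -> : rdot x (expj (- theta) *: (C *m x)) = 0.
  by rewrite y0' scaler0 -(subrr x) rdotDr rdotNr subrr.
by rewrite !mul0r mulr0.
Qed.

Lemma rdot_transverse theta C x : x != 0 -> rdot x (transverse theta C x) = 0.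
Proof.
move=> x0; rewrite /transverse rdotDr rdotNr rdotZr /axial divfK ?subrr //.
by rewrite rdot_eq0.
Qed.

(** By Pythagoras the squared axial and relative transverse lengths add up to the squared gain; the
    sine is nonnegative on [0, pi], so comparing squares suffices. *)
Lemma transverseE theta C x : x != 0 ->
  enorm (transverse theta C x) / enorm x =
  gain C x * sin (vangle x (expj (- theta) *: (C *m x))).
Proof.
move=> x0; set y := expj (- theta) *: (C *m x).
have ex0 : enorm x != 0 by rewrite enorm_eq0.
have hs : 0 <= sin (vangle x y) by rewrite sin_ge0_pi // vangle_bound.
apply/eqP; rewrite -(@eqrXn2 _ 2) ?mulr_ge0 ?invr_ge0 ?gain_ge0 ?enorm_ge0 //.
have -> : (gain C x * sin (vangle x y)) ^+ 2 = gain C x ^+ 2 - axial theta C x ^+ 2.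
  transitivity (gain C x ^+ 2 * sin (vangle x y) ^+ 2); first by ring.
  by rewrite axialE // sin2cos2 acosK ?in_itv /= ?vcos_bound // -/y; ring.
rewrite expr_div_n (sqr_enorm (transverse _ _ _)).
rewrite {1}/transverse rdotDl rdotNl rdotZl rdot_transverse // mulr0 subr0.
rewrite /transverse -/y rdotDr rdotNr rdotZr (rdotC y x).
have -> : rdot x y = axial theta C x * enorm x ^+ 2.
  by rewrite sqr_enorm /axial divfK // rdot_eq0.
have -> : rdot y y = (gain C x * enorm x) ^+ 2.
  by rewrite /gain divfK // sqr_enorm rdot_expj.
by apply/eqP; field.
Qed.

Lemma SRG_cartesian theta C x t : x != 0 ->
  `|t| = enorm (transverse theta C x) / enorm x ->
  SRG theta C ((axial theta C x +i* t) * expj theta).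
Proof.
move=> x0; rewrite transverseE // axialE //; set y := _ *: _ => ht.
have /andP[psi0 _] := vangle_bound x y.
have cosE : vcos x y = cos (vangle x y) by rewrite acosK ?in_itv ?vcos_bound.
have [t0|t0] := leP 0 t.
  have -> : gain C x * vcos x y +i* t = (gain C x)%:C * expj (vangle x y).
    apply: complex_eqP; rewrite /= ?cosE; first by ring.
    by rewrite mul0r addr0 -ht ger0_norm.
  rewrite -mulrA -expjD addrC; apply: SRG_polar => //.
  by rewrite ger0_norm.
have -> : gain C x * vcos x y +i* t = (gain C x)%:C * expj (- vangle x y).
  apply: complex_eqP; rewrite /= ?cosE cosN sinN; first by ring.
  by rewrite mulrN -ht ltr0_norm //; ring.
rewrite -mulrA -expjD addrC; apply: SRG_polar => //.
by rewrite normrN ger0_norm.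
Qed.

(** In the frame turned by [theta] the chord is the vertical segment between the conjugate points a
    + js and a - js, so it contains every a + jt with |t| <= s. *)
Lemma chord_fill theta S C x t : x != 0 -> S C -> chord_property theta S ->
  `|t| <= enorm (transverse theta C x) / enorm x ->
  SRG_set theta S ((axial theta C x +i* t) * expj theta).
Proof.
move=> x0 SC hS; set a := axial theta C x; set s := _ / _ => hts.
have s0 : 0 <= s := le_trans (normr_ge0 t) hts.
have hz : SRG_set theta S ((a +i* s) * expj theta).
  by exists C => //; apply: SRG_cartesian; rewrite ?ger0_norm.
have [s00|sn0] := eqVneq s 0.
  by move: hts; rewrite s00 normr_le0 => /eqP ->; move: hz; rewrite s00.
(* The weight u of the mirror image solves (1 - u) s - u s = t. *)
apply: hS hz _ _; exists ((1 - t / s) / 2).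
  have : `|t / s| <= 1.
    by rewrite normrM normfV (ger0_norm s0) ler_pdivrMr ?mul1r // lt0r sn0.
  by rewrite ler_norml => /andP[h1 h2]; apply/andP; split; lra.
have hJ : ((a +i* s) * expj theta)^* * expj (2 * theta) =
    (a -i* s) * expj theta.
  have -> : expj (2 * theta) = expj theta * expj theta.
    by rewrite -expjD; congr expj; ring.
  have hu : (expj theta)^* * expj theta = 1.
    apply: complex_eqP; rewrite /=; last by ring.
    by rewrite mulNr opprK -!expr2 cos2Dsin2.
  by rewrite rmorphM /= mulrACA hu mulr1.
rewrite hJ !mulrA -mulrDl; congr (_ * _).
by apply: complex_eqP; rewrite /= ?mul0r; field.
Qed.

(* An arc crossing the negative ray of theta crosses the positive ray of
   theta + pi, with half-angle pi - psi instead of psi. *)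
Lemma arc_fill theta S C x : x != 0 -> S C -> arc_property theta S ->
  exists th' : R, forall phi,
    `|phi| <= vangle x (expj (- th') *: (C *m x)) ->
    SRG_set theta S ((gain C x)%:C * expj (th' + phi)).
Proof.
move=> x0 SC hS; set psi := vangle x (expj (- theta) *: (C *m x)).
have /andP[psi0 psipi] : 0 <= psi <= pi := vangle_bound _ _.
set z := (gain C x)%:C * expj (theta + psi).
have zE : cmod z = gain C x by rewrite cmod_polar ?gain_ge0.
have hz : SRG_set theta S z by exists C => //; apply: SRG_polar; rewrite ?ger0_norm.
have hpsi : polar_angle theta z psi.
  by rewrite /polar_angle zE psi0 psipi; split=> //; left.
case: hS => /(_ _ hz) hS.
  exists theta => phi hphi; apply: hS.
  by exists psi, phi; split=> //; rewrite zE.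
exists (theta + pi) => phi.
have -> : expj (- (theta + pi)) = - expj (- theta).
  have -> : - theta = - (theta + pi) + pi by ring.
  by rewrite expjDpi opprK.
rewrite scaleNr vangleNr -/psi ler_norml => /andP[h1 h2].
(* The phase pi + phi is reduced modulo 2 pi to absolute value pi - |phi|, which lies between psi
   and pi. *)
apply: hS; have [phi0|phi0] := leP phi 0.
  exists psi, (pi + phi); split=> //.
    by rewrite ger0_norm; [apply/andP; split|]; lra.
  by rewrite zE; congr (_ * expj _); ring.
exists psi, (phi - pi); split=> //.
  by rewrite ler0_norm; [apply/andP; split|]; lra.
rewrite zE; congr (_ * _).
have -> : theta + pi + phi = theta + (phi - pi) + pi + pi by ring.
by rewrite !expjDpi opprK.
Qed.

End ScaledRelativeGraph.

(** * Choosing signed terms with a prescribed sum, and the exceptional index *)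

(* The terms other than k are scaled by a common factor. *)
Lemma signed_balance (R : realFieldType) (I : finType) (s : I -> R) (d : R) k :
  (forall i, 0 <= s i) -> `|d| <= \sum_i s i -> s k *+ 2 <= `|d| + \sum_i s i ->
  exists t : I -> R, [/\ forall i, `|t i| <= s i, `|t k| = s k & \sum_i t i = d].
Proof.
move=> s0; rewrite (bigD1 k) //=; set T := \sum_(i | _) _ => hd hk.
have T0 : 0 <= T by apply: sumr_ge0.
(* A sign of [d] that is never 0, so that |t k| = s k also when d = 0. *)
pose e : R := if 0 <= d then 1 else -1.
have e1 : `|e| = 1 by rewrite /e; case: ifP; rewrite ?normrN normr1.
have de : d = e * `|d|.
  by rewrite /e; case: ger0P => _; rewrite ?mul1r ?mulN1r ?opprK.
(* This solves e s_k + c T = d when T is nonzero; the two hypotheses bound | |d| - s_k | by T,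
   whence |c| <= 1. *)
pose c := e * ((`|d| - s k) / T).
have c1 : `|c| <= 1.
  rewrite /c normrM e1 mul1r; have [->|Tn0] := eqVneq T 0.
    by rewrite invr0 mulr0 normr0.
  rewrite normrM normfV (ger0_norm T0) ler_pdivrMr ?lt0r ?Tn0 // mul1r.
  by rewrite ler_norml; apply/andP; split; lra.
exists (fun i => if i == k then e * s k else c * s i); split=> [i||].
- case: eqP => [->|_]; first by rewrite normrM e1 mul1r ger0_norm.
  by rewrite normrM (ger0_norm (s0 i)) ler_piMl.
- by rewrite eqxx normrM e1 mul1r ger0_norm.
rewrite (bigD1 k) //= eqxx.
rewrite (eq_bigr (fun i => c * s i)) => [|i /negPf -> //].
rewrite -mulr_sumr -/T /c -mulrA -mulrDr [RHS]de; congr (_ * _).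
(* If T = 0 the two hypotheses force |d| = s_k. *)
have [T00|Tn0] := eqVneq T 0; last by rewrite divfK //; ring.
by rewrite T00 mulr0; move: hd hk; rewrite T00; lra.
Qed.

(** The complement of [J] has at most one element, which is taken as [k]; if it is empty, any index
    will do. *)
Lemma at_least_but_one (N : nat) (P : 'I_N.+1 -> Prop) :
  at_least (N.+1 - 1) P -> exists k, forall i, i != k -> P i.
Proof.
rewrite subn1 => -[J hJ hP].
have hcard : (#|~: J| <= 1)%N by move: (cardsC J) hJ; rewrite card_ord /=; lia.
have [J0|[k kJ]] := set_0Vmem (~: J).
  exists ord0 => i _; apply: hP; have := finset.in_set0 i.
  by rewrite -J0 inE => /negbFE.
exists k => i ik; apply: hP; apply/negPn/negP => iJ.
have : [set k; i] \subset ~: J by rewrite finset.subUset !finset.sub1set kJ inE iJ.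
by move/subset_leq_card; rewrite cards2 eq_sym ik => /leq_trans/(_ hcard).
Qed.

(** * The triangle inequality for angles along paths of vectors *)

Section Paths.
Variables (R : realType) (n : nat).

Lemma vangle_path (v : nat -> 'cV[R[i]]_n) p q : (p <= q)%N ->
  (forall i, (p <= i <= q)%N -> v i != 0) ->
  vangle (v p) (v q) <= \sum_(p <= i < q) vangle (v i) (v i.+1).
Proof.
move=> pq; have vv u : u != 0 -> vangle u u = 0.
  by move=> u0; rewrite -{2}(scale1r u) -expj0 vangle_expjr // cos0 acos1.
elim: q pq => [|q IH].
  by rewrite leqn0 => /eqP -> hv; rewrite big_geq // vv ?hv.
rewrite leq_eqVlt => /predU1P[-> hv|]; first by rewrite big_geq // vv ?hv ?leqnn.
rewrite ltnS => pq hv; rewrite big_nat_recr //=.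
have hp : v p != 0 by rewrite hv // leqnn leqW.
have hq : v q != 0 by rewrite hv // pq leqnSn.
have hq1 : v q.+1 != 0 by rewrite hv // leqnn leqW.
apply: le_trans (vangle_triangle hp hq hq1) _.
by rewrite lerD2r IH // => i /andP[pi iq]; rewrite hv // pi leqW.
Qed.

(* With v_i = e^{-j(theta_i + ... + theta_(N-1))} y_i the angles between
   consecutive v_i are those of the hypothesis, and d is the phase of
   -e^{-j sum theta}, which turns v_N into v_0. *)
Lemma phase_balance (N : nat) (y : nat -> 'cV[R[i]]_n) (theta : nat -> R) k :
  (k < N)%N -> (forall i, (i <= N)%N -> y i != 0) -> y 0 = - y N ->
  let psi i := vangle (y i.+1) (expj (- theta i) *: y i) in
  exists d : R, [/\ expj (\sum_(0 <= i < N) theta i + d) = -1,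
    `|d| <= \sum_(0 <= i < N) psi i &
    psi k *+ 2 <= `|d| + \sum_(0 <= i < N) psi i].
Proof.
move=> kN y0 y0N psi.
pose v i := expj (- \sum_(i <= m < N) theta m) *: y i.
have hv i : (i <= N)%N -> v i != 0.
  by move=> iN; rewrite -enorm_eq0 enorm_expj enorm_eq0 y0.
have psiE i : (i < N)%N -> vangle (v i) (v i.+1) = psi i.
  move=> iN; rewrite vangleC /v (big_ltn iN) opprD addrC expjD -scalerA.
  by rewrite vangle_expj.
have sumE p q : (q <= N)%N ->
    \sum_(p <= i < q) vangle (v i) (v i.+1) = \sum_(p <= i < q) psi i.
  move=> qN; apply: eq_big_nat => i /andP[_ iq].
  by rewrite psiE // (leq_trans iq).
set Theta := \sum_(0 <= i < N) theta i.
have [d dE dN] := expj_principal (- Theta + pi).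
have ends : `|d| = vangle (v 0) (v N).
  rewrite dN /v -/Theta y0N [\sum_(N <= _ < _) _]big_geq // oppr0 expj0 scale1r.
  by rewrite scalerN -scaleNr -expjDpi vangleC vangle_expjr ?y0.
exists d; split.
- by rewrite expjD dE -expjD addrA subrr add0r -[pi]add0r expjDpi expj0.
- by rewrite ends -sumE // vangle_path // => i /andP[_]; apply: hv.
have h1 : vangle (v 0) (v k) <= \sum_(0 <= i < k) psi i.
  rewrite -sumE ?(ltnW kN) // vangle_path // => i /andP[_ ik].
  by rewrite hv // (leq_trans ik) // ltnW.
have h2 : vangle (v k.+1) (v N) <= \sum_(k.+1 <= i < N) psi i.
  rewrite -(sumE _ _ (leqnn N)); apply: vangle_path => // i /andP[_ iN].
  exact: hv.
(* The k-th edge is bounded by the rest of the closed polygon: from [v k] back to [v 0], across to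
   [v N], then back to [v k.+1]. *)
have h3 : psi k <= vangle (v 0) (v k) + (`|d| + vangle (v k.+1) (v N)).
  have hk : v k != 0 by rewrite hv // ltnW.
  rewrite -psiE // (vangleC (v 0) (v k)) (vangleC (v k.+1)) ends.
  apply: le_trans (vangle_triangle hk (hv 0 _) (hv k.+1 _)) _ => //.
  by rewrite lerD2l vangle_triangle ?hv.
have -> : \sum_(0 <= i < N) psi i =
    \sum_(0 <= i < k) psi i + (psi k + \sum_(k.+1 <= i < N) psi i).
  by rewrite -(big_ltn kN) -big_cat_nat // ltnW.
move: (psi k) h1 h2 h3 => p; move: (vangle _ _) (vangle _ _) `|d| => u w e.
lra.
Qed.

End Paths.

(** * Singularity puts -1 into the sum or product of the graphs *)

Section Main.
Variables (R : realType) (n N : nat) (A : 'I_N.+1 -> 'M[R[i]]_n).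
Variables (calA : 'I_N.+1 -> set 'M[R[i]]_n).
Hypothesis calAA : forall i, calA i (A i).

Lemma singular_sum_SRG (theta : R) :
  at_least (N.+1 - 1) (fun i => chord_property theta (calA i)) ->
  1%:M + \sum_i A i \notin unitmx ->
  sum_sets (fun i => SRG_set theta (calA i)) (- 1).
Proof.
move=> /at_least_but_one[k hchord] /singular_kernel[x x0 hx].
have ex0 : enorm x != 0 by rewrite enorm_eq0.
have xx0 : rdot x x != 0 by rewrite rdot_eq0.
have {}hx : \sum_i A i *m x = - x.
  by apply/eqP; rewrite -addr_eq0 addrC -mulmx_suml -{1}(mul1mx x) -mulmxDl hx.
pose a i := axial theta (A i) x; pose r i := transverse theta (A i) x.
have yE i : expj (- theta) *: (A i *m x) = (a i)%:C *: x + r i.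
  by rewrite /r /transverse addrC subrK.
have sum_yE : expj (- theta) *: - x = (\sum_i a i)%:C *: x + \sum_i r i.
  rewrite -hx scaler_sumr rmorph_sum scaler_suml -big_split.
  by apply: eq_bigr => i _; rewrite yE.
(* Pairing with [x] removes the transverse vectors. *)
have sum_a : \sum_i a i = - cos theta.
  have xr : rdot x (\sum_i r i) = 0.
    by rewrite rdotC rdot_suml big1 // => i _; rewrite rdotC rdot_transverse.
  have := congr1 (rdot x) sum_yE; rewrite rdotDr rdotZr xr addr0.
  by rewrite scalerN rdotNr rdot_expjr cosN -mulNr => /(mulIf xx0).
(* This is -e^{-j theta} + cos theta = j sin theta, with j written as a phase so that [enorm_expj]
   applies. *)
have sum_r : \sum_i r i = (sin theta)%:C *: (expj (pi / 2) *: x).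
  have -> : \sum_i r i = expj (- theta) *: - x - (\sum_i a i)%:C *: x.
    by rewrite sum_yE addrC addKr.
  rewrite sum_a scalerN -!scaleNr -scalerDl scalerA; congr (_ *: x).
  by apply: complex_eqP; rewrite /= cos_pihalf sin_pihalf ?cosN ?sinN; ring.
pose s i := enorm (r i) / enorm x.
have s0 i : 0 <= s i by rewrite divr_ge0 ?enorm_ge0.
have enorm_sin : enorm (\sum_i r i) / enorm x = `|sin theta|.
  by rewrite sum_r enormZ enorm_expj mulfK.
have sin_le : `|sin theta| <= \sum_i s i.
  by rewrite -enorm_sin -mulr_suml ler_wpM2r ?invr_ge0 ?enorm_ge0 // enorm_sum.
have s_le : s k *+ 2 <= `|sin theta| + \sum_i s i.
  rewrite (bigD1 k) //= mulr2n addrCA lerD2l -enorm_sin -mulr_suml -mulrDl.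
  rewrite ler_wpM2r ?invr_ge0 ?enorm_ge0 //.
  have -> : r k = \sum_i r i + - \sum_(i | i != k) r i.
    by rewrite [in RHS](bigD1 k) //= addrK.
  by apply: le_trans (enormD _ _) _; rewrite enormN lerD2l enorm_sum.
have [t [ht htk sum_t]] := signed_balance s0 sin_le s_le.
exists (fun i => (a i +i* t i) * expj theta) => [i|].
  (* At [k] no chord is available, but |t k| = s k makes the point one of the graph of [A k]
     itself. *)
  have [->|ik] := eqVneq i k; last exact: chord_fill (hchord i ik) (ht i).
  by exists (A k) => //; apply: SRG_cartesian.
have -> : \sum_i (a i +i* t i) * expj theta =
    ((\sum_i a i) +i* (\sum_i t i)) * expj theta.
  rewrite -mulr_suml; congr (_ * _).
  apply: complex_eqP; rewrite /= ?(raddf_sum (@complex.Re R : Rcomplex R -> R)) //.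
  by rewrite (raddf_sum (@complex.Im R : Rcomplex R -> R)).
(* The first factor is -e^{-j theta}. *)
rewrite sum_a sum_t; apply: complex_eqP; rewrite /=; last by ring.
by rewrite mulNr -opprD -!expr2 cos2Dsin2.
Qed.

Lemma singular_prod_SRG (theta : 'I_N.+1 -> R) :
  at_least (N.+1 - 1) (fun i => arc_property (theta i) (calA i)) ->
  1%:M + \prod_i A i \notin unitmx ->
  prod_sets (fun i => SRG_set (theta i) (calA i)) (- 1).
Proof.
move=> /at_least_but_one[k harc] /singular_kernel[x x0 hx].
(* Indexing by naturals gives access to interval products; the default 1 is never reached below
   [N.+1]. *)
pose F m := if insub m is Some i then A i else 1.
have FE (i : 'I_N.+1) : F i = A i by rewrite /F valK.
pose y m := (\prod_(m <= i < N.+1) F i) *m x.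
have yS (i : 'I_N.+1) : y i = A i *m y i.+1.
  by rewrite /y big_ltn // FE mulmxA.
have yN : y N.+1 = x by rewrite /y big_geq // mul1mx.
have y0 : y 0 = - y N.+1.
  apply/eqP; rewrite -addr_eq0 yN /y big_mkord addrC -{1}(mul1mx x) -mulmxDl -hx.
  by rewrite (eq_bigr A) // => i _.
(* Since y_i = A_i y_(i+1), a zero vector would propagate down to y_0 = -x. *)
have yn0 i : (i <= N.+1)%N -> y i != 0.
  elim: i => [|i IH] iN; first by rewrite y0 yN oppr_eq0.
  by apply: contraNneq (IH (ltnW iN)) => yi; rewrite (yS (Ordinal iN)) yi mulmx0.
pose mem (i : 'I_N.+1) t phi :=
  SRG_set (theta i) (calA i) ((gain (A i) (y i.+1))%:C * expj (t + phi)).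
pose psi (i : 'I_N.+1) t := vangle (y i.+1) (expj (- t) *: y i).
(* The reference phase is [theta k] at [k] and comes from [arc_fill] elsewhere, possibly shifted by
   pi. Stating both clauses for every [i] allows a single choice function. *)
have /fin_all_exists[th hth] (i : 'I_N.+1) : exists t : R,
    (forall phi, `|phi| = psi i t -> mem i t phi) /\
    (i != k -> forall phi, `|phi| <= psi i t -> mem i t phi).
  rewrite /psi yS; have [->|ik] := eqVneq i k.
    exists (theta k); split=> // phi hphi; exists (A k) => //.
    by apply: SRG_polar; rewrite ?yn0.
  have [t ht] := arc_fill (yn0 i.+1 (ltn_ord i)) (calAA i) (harc i ik).
  by exists t; split=> // phi hphi; apply: ht; rewrite hphi.
pose th' m := if insub m is Some i then th i else 0.
have thE (i : 'I_N.+1) : th' i = th i by rewrite /th' valK.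
have [d []] := phase_balance th' (ltn_ord k) yn0 y0.
rewrite !big_mkord thE; under eq_bigr do rewrite thE.
under [X in _ <= X]eq_bigr do rewrite thE.
under [X in _ <= _ + X]eq_bigr do rewrite thE.
move=> hd d_le psik_le.
have psi_ge0 i : 0 <= psi i (th i).
  by case/andP: (vangle_bound (y i.+1) (expj (- th i) *: y i)).
have [phi [hphi hphik sum_phi]] := signed_balance psi_ge0 d_le psik_le.
exists (fun i => (gain (A i) (y i.+1))%:C * expj (th i + phi i)) => [i|].
  have [hi1 hi2] := hth i.
  by have [ik|ik] := eqVneq i k; [apply: hi1; rewrite ik | apply: hi2].
(* The phases add up to that of -1; it remains to see that the moduli multiply to 1. *)
rewrite big_split /= -expj_sum big_split /= sum_phi hd.
have -> : \prod_i (gain (A i) (y i.+1))%:C = 1.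
  have -> : \prod_i (gain (A i) (y i.+1))%:C =
      (\prod_(0 <= i < N.+1) (enorm (y i) / enorm (y i.+1)))%:C.
    by rewrite rmorph_prod big_mkord; apply: eq_bigr => i _; rewrite /gain -yS.
  (* The gains telescope to |y_0| / |y_(N+1)|, the quotient of two vectors of equal norm. *)
  rewrite telescope_prodr // => [|i /andP[_ iN]]; last first.
    by rewrite unitfE enorm_eq0 yn0 // ltnW.
  by rewrite y0 enormN divff // enorm_eq0 yn0.
by rewrite mul1r.
Qed.

End Main.

Theorem theorem4 (R : realType) (n N : nat) (A : 'I_N -> 'M[R[i]]_n) :
  ((exists (theta : R) (calA : 'I_N -> set 'M[R[i]]_n),
      [/\ forall i : 'I_N, calA i (A i),
          at_least (N - 1) (fun i : 'I_N => chord_property theta (calA i)) &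
          ~ sum_sets (fun i : 'I_N => SRG_set theta (calA i)) (- 1)]) ->
   1%:M + \sum_(i < N) A i \in unitmx)
  /\
  ((exists (theta : 'I_N -> R) (calA : 'I_N -> set 'M[R[i]]_n),
      [/\ forall i : 'I_N, calA i (A i),
          at_least (N - 1) (fun i : 'I_N => arc_property (theta i) (calA i)) &
          ~ prod_sets (fun i : 'I_N => SRG_set (theta i) (calA i)) (- 1)]) ->
   1%:M + \prod_(i < N) A i \in unitmx).
Proof.
split=> [[theta [calA [hA hprop hN]]]|[theta [calA [hA hprop hN]]]];
  case: N A theta calA hA hprop hN => [|N] A theta calA hA hprop hN.
- by rewrite big_ord0 addr0 unitmx1.
- by apply: contra_notT hN; apply: singular_sum_SRG.
(* The empty product is the identity, so the matrix is 2I, with determinant 2^n. *)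
- rewrite big_ord0 -[1%:M + 1]/(1%:M + 1%:M) -raddfD unitmxE det_scalar.
  by rewrite unitfE expf_neq0 // (pnatr_eq0 _ 2).
- by apply: contra_notT hN; apply: singular_prod_SRG.
Qed.
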